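(* Let $N\ge3$ and let $V\colon\mathbb{R}^N\to\mathbb{R}$ be continuous with $\inf_{\mathbb{R}^N}V>0$. Suppose that there exist positive constants $c_1,c_2,m$ and a sequence $\{x_n\}_n$ in $\mathbb{R}^N$ such that $V(x_n)\to+\infty$ and \[ c_1V(x_n)\le V(x)\le c_2V(x_n)\quad\text{for all } x\in B_{m/\sqrt{V(x_n)}}(x_n)\text{ and all }n . \] Then $H^1_V(\mathbb{R}^N)\setminus L^\tau_V(\mathbb{R}^N)\neq\emptyset$ for every $\tau>2$.
   Context: $H^1_V(\mathbb{R}^N)$ is the completion of $C_0^\infty(\mathbb{R}^N)$ with respect to the norm $\|u\|_V=\left(\int_{\mathbb{R}^N}(|\nabla u|^2+V(x)|u|^2)\,dx\right)^{1/2}$. $L^\tau_V(\mathbb{R}^N)$ is the space of measurable $u$ with $\int_{\mathbb{R}^N}V(x)|u|^\tau dx<+\infty$. $B_r(x)$ denotes the open ball of radius $r$ centered at $x$. *)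

(* Defs.v *)
From HB Require Import structures.
From mathcomp Require Import all_boot all_order all_algebra.
From mathcomp Require Import all_classical all_reals all_analysis.
Set Implicit Arguments. Unset Strict Implicit. Unset Printing Implicit Defensive.
Import Order.TTheory GRing.Theory Num.Theory.
Import numFieldNormedType.Exports.
Local Open Scope classical_set_scope.
Local Open Scope ring_scope.

Section Defs.
Variable R : realType.

(* Euclidean norm on R^N (the library norm on matrices is the sup norm). *)
Definition eucl_norm N (x : 'rV[R]_N) : R := Num.sqrt (\sum_(i < N) x ord0 i ^+ 2).

Definition ebase N (i : 'I_N) : 'rV[R]_N := delta_mx ord0 i.

Fixpoint Ck N (k : nat) (f : 'rV[R]_N -> R) : Prop :=
  match k with
  | 0 => continuous f
  | k'.+1 => continuous f /\
      forall i : 'I_N, (forall x, derivable f x (ebase i)) /\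
                       Ck k' (fun x => derive f x (ebase i))
  end.

Definition smooth N (f : 'rV[R]_N -> R) : Prop := forall k, Ck k f.

Definition Cc_inf N (f : 'rV[R]_N -> R) : Prop :=
  smooth f /\ exists r : R, forall x, r < eucl_norm x -> f x = 0.

Definition grad_sq N (f : 'rV[R]_N -> R) (x : 'rV[R]_N) : R :=
  \sum_(i < N) (derive f x (ebase i)) ^+ 2.

(* Lebesgue integral over R^N of a nonnegative function, computed as the
   iterated integral over the coordinates (equal to the product-measure
   integral by Tonelli for nonnegative measurable integrands). *)
Fixpoint intRN (N : nat) : ('rV[R]_N -> \bar R) -> \bar R :=
  match N return ('rV[R]_N -> \bar R) -> \bar R with
  | 0 => fun g => g 0
  | n.+1 => fun g =>
      (\int[@lebesgue_measure R]_(t in [set: R])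
          intRN (fun y : 'rV[R]_n => g (row_mx (\row_(j < 1) t) y)))%E
  end.

(* Borel measurability on R^N, via the product sigma-algebra on N-tuples. *)
Definition measurableRN N (u : 'rV[R]_N -> R) : Prop :=
  measurable_fun [set: N.-tuple R] (fun t : N.-tuple R => u (\row_i tnth t i)).

Definition normV_sq N (V : 'rV[R]_N -> R) (f : 'rV[R]_N -> R) : \bar R :=
  intRN (fun x => (grad_sq f x + V x * f x ^+ 2)%:E).

(* H^1_V(R^N): completion of C_0^infty w.r.t. ||.||_V, its elements realised
   as functions u: u is the L^2_V-limit of a ||.||_V-Cauchy sequence of
   C_0^infty functions. *)
Definition H1V N (V : 'rV[R]_N -> R) (u : 'rV[R]_N -> R) : Prop :=
  measurableRN u /\
  exists phi : nat -> 'rV[R]_N -> R,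
    (forall k, Cc_inf (phi k)) /\
    (forall eps : R, 0 < eps -> exists K : nat, forall k l, (K <= k)%N -> (K <= l)%N ->
        (normV_sq V (fun x => (phi k x - phi l x)%R) <= eps%:E)%E) /\
    (forall eps : R, 0 < eps -> exists K : nat, forall k, (K <= k)%N ->
        (intRN (fun x => (V x * (phi k x - u x) ^+ 2)%R%:E) <= eps%:E)%E).

Definition LtauV N (V : 'rV[R]_N -> R) (tau : R) (u : 'rV[R]_N -> R) : Prop :=
  measurableRN u /\ (intRN (fun x => (V x * (`|u x| `^ tau))%R%:E) < +oo)%E.

End Defs.

(* Main.v *)
(* Along a subsequence with V(x_(k+1)) > (c2/c1) V(x_k), the two-sided bound on
   V makes the balls around the x_k disjoint, since V takes incompatible values
   on them.  Put s_k = sqrt (V(x_k)) and let phi_k be a fixed smooth bump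
   rescaled to width ~ 1/s_k around x_k.  Both |grad phi_k|^2 and V phi_k^2 are
   O(s_k^2) on a cube of volume ~ s_k^-N, so with a_k^2 = s_k^(N-2) 2^-k the sum
   of the a_k phi_k converges in H^1_V, whereas the integral of V |a_k phi_k|^tau
   is at least a constant times a_k^tau s_k^(2-N), which is s_k^((N-2)(tau/2-1))
   up to a factor depending only on k and tau.  As N > 2 and tau > 2, this
   exceeds any prescribed bound when V(x_k) is large enough. *)

Require Import Defs.
From HB Require Import structures.
From mathcomp Require Import all_boot all_order all_algebra.
From mathcomp Require Import all_classical all_reals all_analysis.
From mathcomp Require Import measurable_realfun.
From mathcomp Require Import ring lra.
Import Order.TTheory GRing.Theory Num.Theory.
Import numFieldNormedType.Exports.
Local Open Scope classical_set_scope.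
Local Open Scope ring_scope.

(** * Iterated integrals and their estimates by boxes *)

Section IteratedIntegral.
Context {R : realType}.

(* The integral of a nonnegative function is by definition a supremum over the
   simple functions below it, measurable or not. *)
Lemma ge0_le_integral_nonmeas (f g : R -> \bar R) :
  (forall x, 0 <= f x)%E -> (forall x, f x <= g x)%E ->
  (\int[@lebesgue_measure R]_(x in [set: R]) f x <=
   \int[@lebesgue_measure R]_(x in [set: R]) g x)%E.
Proof.
move=> f0 fg; have g0 x : (0 <= g x)%E := le_trans (f0 x) (fg x).
rewrite !ge0_integralTE//; apply: le_ereal_sup => _ [h /= hf <-].
by exists h => //= x; exact: le_trans (hf x) (fg x).
Qed.

Lemma intRN_ge0 n (g : 'rV[R]_n -> \bar R) :
  (forall x, 0 <= g x)%E -> (0 <= intRN g)%E.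
Proof.
elim: n g => [|n IH] g g0 //=.
by apply: integral_ge0 => t _; apply: IH.
Qed.

Lemma le_intRN n (f g : 'rV[R]_n -> \bar R) :
  (forall x, 0 <= f x)%E -> (forall x, f x <= g x)%E ->
  (intRN f <= intRN g)%E.
Proof.
elim: n f g => [|n IH] f g f0 fg //=.
by apply: ge0_le_integral_nonmeas => t; [exact: intRN_ge0 | exact: IH].
Qed.

(** Induction on the dimension: for a fixed first coordinate [t], the factor [\1_(I j ord0) t] is
    absorbed into [c j], so the inner integral is again of this form. The outer one is a termwise
    integration of a nonnegative series. *)
Lemma intRN_nneseries_box n (c : nat -> R) (I : nat -> 'I_n -> set R)
    (l : nat -> 'I_n -> R) :
  (forall j, 0 <= c j) ->
  (forall j i, measurable (I j i)) ->
  (forall j i, 0 <= l j i) ->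
  (forall j i, lebesgue_measure (I j i) = (l j i)%:E) ->
  intRN (fun x : 'rV[R]_n =>
    \sum_(j <oo) (c j * \prod_(i < n) \1_(I j i) (x ord0 i))%:E)%E =
  (\sum_(j <oo) (c j * \prod_(i < n) l j i)%:E)%E.
Proof.
elim: n c I l => [|n IH] c I l c0 mI l0 muI /=.
  by apply: eq_eseriesr => j _; rewrite !big_ord0.
transitivity (\int[@lebesgue_measure R]_(t in [set: R])
  \sum_(j <oo) ((c j * \prod_(i < n) l j (lift ord0 i)) *
     \1_(I j ord0) t)%:E)%E.
  apply: eq_integral => t _.
  rewrite -[RHS](_ : \sum_(j <oo) ((c j * \1_(I j ord0) t) *
     \prod_(i < n) l j (lift ord0 i))%:E = _)%E; last first.
    by apply: eq_eseriesr => j _; rewrite mulrAC.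
  rewrite -(IH (fun j => c j * \1_(I j ord0) t)
             (fun j i => I j (lift ord0 i))) //; last first.
    by move=> j; rewrite mulr_ge0.
  congr intRN; apply/funext => y; apply: eq_eseriesr => j _.
  rewrite big_ord_recl mulrA; congr (_ * _ * _)%:E.
    congr (\1_ _ _); rewrite mxE.
    by case: splitP => [k _|k //]; rewrite mxE.
  apply: eq_bigr => i _; congr (\1_ _ _).
  rewrite mxE; case: splitP => [k|k [ik]]; first by case: k => [[]].
  by congr (y _ _); apply/val_inj.
have p0 j : 0 <= c j * \prod_(i < n) l j (lift ord0 i).
  by rewrite mulr_ge0// prodr_ge0.
rewrite integral_nneseries//.
- apply: eq_eseriesr => j _.
  under eq_integral do rewrite EFinM.
  rewrite ge0_integralZl_EFin//.
  + rewrite integral_indic; [|exact: measurableT|exact: mI].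
    by rewrite setIT [X in (_ * X)%E](muI j ord0) -EFinM big_ord_recl mulrAC mulrA.
  + by apply/measurable_EFinP; exact: measurable_indic (mI j ord0).
- move=> j; apply/measurable_EFinP; apply: measurable_funM; first exact: measurable_cst.
  exact: measurable_indic (mI j ord0).
- by move=> j t _; rewrite lee_fin mulr_ge0.
Qed.

(** Where [g] does not vanish, a single term of the series of weighted box indicators already
    dominates it; [B] bounds the total weighted volume. *)
Lemma le_intRN_nneseries_box n (g : 'rV[R]_n -> R) (c : nat -> R)
    (I : nat -> 'I_n -> set R) (l : nat -> 'I_n -> R) (B : R) :
  (forall j, 0 <= c j) ->
  (forall j i, measurable (I j i)) ->
  (forall j i, 0 <= l j i) ->
  (forall j i, lebesgue_measure (I j i) = (l j i)%:E) ->
  (forall x, 0 <= g x) ->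
  (forall x, g x = 0 \/
     exists2 j, (forall i, I j i (x ord0 i)) & g x <= c j) ->
  (forall k, \sum_(j < k) c j * \prod_(i < n) l j i <= B) ->
  (intRN (fun x => (g x)%:E) <= B%:E)%E.
Proof.
move=> c0 mI l0 muI g0 gc sB.
have ci x j : (0 <= (c j * \prod_(i < n) \1_(I j i) (x ord0 i : R))%:E)%E.
  by rewrite lee_fin mulr_ge0// prodr_ge0.
apply: (@le_trans _ _ (intRN (fun x : 'rV[R]_n =>
    \sum_(j <oo) (c j * \prod_(i < n) \1_(I j i) (x ord0 i))%:E)%E)).
  apply: le_intRN => x; first by rewrite lee_fin.
  have [->|[j xj gj]] := gc x; first exact: nneseries_ge0.
  rewrite (@nneseriesD1 _ _ j)//.
  apply: (@le_trans _ _ ((c j * \prod_(i < n) \1_(I j i) (x ord0 i))%:E)).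
    rewrite lee_fin big1 ?mulr1// => i _.
    by rewrite indicE mem_set.
  by rewrite leeDl// nneseries_ge0.
rewrite (@intRN_nneseries_box _ c I l)//.
apply: lime_le.
  by apply: is_cvg_nneseries => j _ _; rewrite lee_fin mulr_ge0// prodr_ge0.
by apply: nearW => k; rewrite big_mkord sumEFin lee_fin.
Qed.

(** One box is a series whose coefficients vanish after index 0, so the exact formula for series
    integrates the minorant. *)
Lemma ge_intRN_box n (g : 'rV[R]_n -> R) (c : R)
    (I : 'I_n -> set R) (l : 'I_n -> R) :
  0 <= c ->
  (forall i, measurable (I i)) ->
  (forall i, 0 <= l i) ->
  (forall i, lebesgue_measure (I i) = (l i)%:E) ->
  (forall x, 0 <= g x) ->
  (forall x : 'rV[R]_n, (forall i, I i (x ord0 i)) -> c <= g x) ->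
  ((c * \prod_(i < n) l i)%:E <= intRN (fun x => (g x)%:E))%E.
Proof.
move=> c0 mI l0 muI g0 gc.
pose c' j := if j is 0%N then c else 0.
have c'0 j : 0 <= c' j by case: j.
have tail (p : nat -> R) : (forall j, 0 <= p j) ->
    (\sum_(j <oo) (c' j * p j)%:E = (c * p 0%N)%:E)%E.
  move=> p0.
  rewrite (@nneseriesD1 _ _ 0%N)// => [|[|j] _]; rewrite ?mul0r//; last first.
    by rewrite lee_fin mulr_ge0.
  by rewrite eseries0 ?adde0// => -[|j] _ //=; rewrite mul0r.
have := @intRN_nneseries_box n c' (fun _ => I) (fun _ => l) c'0
  (fun _ => mI) (fun _ => l0) (fun _ => muI).
rewrite tail => [<-|j]; last exact: prodr_ge0.
 apply: le_intRN => x.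
  by apply: nneseries_ge0 => j _ _; rewrite lee_fin mulr_ge0// prodr_ge0.
rewrite (tail (fun _ => _)) => [|j]; last exact: prodr_ge0.
rewrite lee_fin.
have [xI|/existsNP[i xI]] := pselect (forall i, I i (x ord0 i)).
  rewrite (le_trans _ (gc x xI))// ler_piMr//.
  by rewrite big1// => i _; rewrite indicE mem_set.
by rewrite (bigD1 i)//= indicE memNset// mul0r mulr0.
Qed.

End IteratedIntegral.

(** * The flat function exp (- 1/x) and a one-variable bump *)

Section FlatFunction.
Context {R : realType}.
Implicit Types (p : {poly R}) (x : R).

(* The derivatives of exp (- 1/x), extended by 0 to x <= 0, all have this
   form, which is why the polynomial is carried along. *)
Definition flat p x : R := if 0 < x then p.[x^-1] * expR (- x^-1) else 0.

Lemma flat_pos p x : 0 < x -> flat p x = p.[x^-1] * expR (- x^-1).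
Proof. by rewrite /flat => ->. Qed.

Lemma flat_nonpos p x : x <= 0 -> flat p x = 0.
Proof. by rewrite /flat ltNge => ->. Qed.

(** The exponential series dominates each of its terms. *)
Lemma expn_expRN_le n (y : R) : 0 <= y -> y ^+ n * expR (- y) <= n`!%:R.
Proof.
move=> y0; rewrite expRN ler_pdivrMr ?expR_gt0//.
case: n => [|n]; first by rewrite expr0 mul1r -expR0 ler_expR.
have := expR_ge1Dxn n y0 => h.
rewrite mulrC -ler_pdivrMr ?ltr0n ?fact_gt0//.
by apply: le_trans h; rewrite lerDr.
Qed.

Lemma flat_bounded p : exists2 C : R, 0 <= C & forall x, `|flat p x| <= C.
Proof.
exists (\sum_(i < size p) `|p`_i| * i`!%:R).
  by apply: sumr_ge0 => i _; rewrite mulr_ge0.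
move=> x; rewrite /flat; case: ifPn => [x0|_]; last first.
  by rewrite normr0; apply: sumr_ge0 => i _; rewrite mulr_ge0.
rewrite horner_coef mulr_suml; apply: le_trans (ler_norm_sum _ _ _) _.
apply: ler_sum => i _; rewrite -mulrA normrM ler_wpM2l//.
have y0 : 0 <= x^-1 by rewrite invr_ge0 ltW.
rewrite ger0_norm ?expn_expRN_le// mulr_ge0 ?expR_ge0//.
by rewrite exprn_ge0.
Qed.

(** The polynomial is evaluated at [x^-1], so a factor ['X^2] costs [x ^- 2]; with [flat_bounded]
    this gives quadratic decay at 0 for every [p]. *)
Lemma flat_mulX2 p x : flat p x = x ^+ 2 * flat ('X^2 * p) x.
Proof.
rewrite /flat; case: ifPn => [x0|_]; last by rewrite mulr0.
have x_neq0 : x != 0 by rewrite gt_eqF.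
by rewrite hornerM hornerXn; field.
Qed.

Lemma flat_near0 p : exists2 C : R, 0 <= C & forall x, `|flat p x| <= C * x ^+ 2.
Proof.
have [C C0 HC] := flat_bounded ('X^2 * p); exists C => // x.
rewrite flat_mulX2 normrM mulrC (ger0_norm (sqr_ge0 x)).
by rewrite ler_wpM2r ?sqr_ge0.
Qed.

(** With y = 1/x, so that dy/dx = - y^2, the derivative of p(y) exp(-y) in x is y^2 (p - p')(y)
    exp(-y). *)
Definition dflat p : {poly R} := 'X^2 * (p - p^`()).

Lemma is_derive_flat p x : is_derive x (1 : R) (flat p) (flat (dflat p) x).
Proof.
have [x0|x0|<-] := ltgtP 0 x.
- apply: (near_eq_is_derive (f := fun y : R => p.[y^-1] * expR (- y^-1))).
    near=> y; rewrite flat_pos//; near: y; exact: lt_nbhsr.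
  have x_neq0 : x != 0 by rewrite gt_eqF.
  have dV : is_derive x (1 : R) (fun y : R => y^-1) (- x ^- 2).
    have := @is_deriveV _ id x 1 1 x_neq0 (is_derive_id _ _).
    by rewrite /GRing.scale/= mulr1.
  have dp := is_derive1_comp (is_derive_poly p x^-1) dV.
  have dN : is_derive x (1 : R) (fun y : R => - y^-1) (x ^- 2).
    by have := is_deriveN dV; rewrite opprK.
  have de := @is_derive1_comp _ expR (fun y : R => - y^-1) x _ _
    (is_derive_expR (- x^-1)) dN.
  apply: is_derive_eq (is_deriveM dp de) _.
  rewrite flat_pos// /dflat hornerM hornerXn hornerD hornerN /GRing.scale/=.
  rewrite exprVn; ring.
- apply: (near_eq_is_derive (f := cst 0)).
    near=> y; rewrite flat_nonpos//; apply/ltW; near: y; exact: lt_nbhsl.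
  by rewrite flat_nonpos ?ltW//; exact: is_derive_cst.
rewrite flat_nonpos//.
(* Quadratic decay bounds the difference quotient at 0 by [C] times the increment. Below, [C + 1]
   replaces [C], which may be 0, as a divisor. *)
have [C C0 HC] := flat_near0 p.
have lim0 : h^-1 *: ((flat p \o shift 0) (h *: (1 : R)) - flat p 0)
    @[h --> 0^'] --> (0 : R).
  rewrite (flat_nonpos _ _ (lexx 0)).
  have C1 : 0 < C + 1 by rewrite ltr_wpDl.
  apply/cvgrPdist_le => e e0; near=> h.
  rewrite sub0r normrN /= /shift /= addr0 subr0 [_ *: 1]mulr1.
  have h0 : h != 0 by near: h; exact: nbhs_dnbhs_neq.
  rewrite normrM normfV mulrC ler_pdivrMr ?normr_gt0//.
  apply: le_trans (HC h) _.
  rewrite -real_normK ?num_real// expr2 mulrA ler_wpM2r//.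
  apply: (@le_trans _ _ ((C + 1) * `|h|)).
    by rewrite ler_wpM2r// lerDl.
  rewrite mulrC -ler_pdivlMr//; near: h.
  by apply: dnbhs0_le; rewrite divr_gt0.
split; first by apply/cvg_ex; exists 0.
exact/cvg_lim.
Unshelve. all: by end_near. Qed.

Lemma continuous_flat p : continuous (flat p).
Proof.
move=> x; apply: differentiable_continuous; apply/derivable1_diffP.
by have [] := is_derive_flat p x.
Qed.

Lemma flat1_le1 x : `|flat 1 x| <= 1.
Proof.
rewrite /flat; case: ifPn => [x0|_]; last by rewrite normr0.
rewrite hornerC mul1r ger0_norm ?expR_ge0// -expR0 ler_expR oppr_le0.
by rewrite invr_ge0 ltW.
Qed.

Lemma flat1_ge0 x : 0 <= flat 1 x.
Proof. by rewrite /flat; case: ifPn => // _; rewrite hornerC mul1r expR_ge0. Qed.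

Lemma flat1_nondecreasing x y : x <= y -> flat 1 x <= flat 1 y.
Proof.
move=> xy; have [x0|x0] := leP x 0; first by rewrite flat_nonpos// flat1_ge0.
have y0 := lt_le_trans x0 xy.
by rewrite !flat_pos// !hornerC !mul1r ler_expR lerN2 lef_pV2.
Qed.

(** A smooth bump, positive exactly on the open interval from -1 to 1; each factor cuts off one
    side. *)
Definition hat (t : R) : R := flat 1 (1 - t) * flat 1 (1 + t).

Definition dhat (t : R) : R :=
  flat 1 (1 - t) * flat (dflat 1) (1 + t) - flat 1 (1 + t) * flat (dflat 1) (1 - t).

Lemma is_derive_hat t : is_derive t (1 : R) hat (dhat t).
Proof.
have dm : is_derive t (1 : R) (fun t : R => 1 - t) (-1).
  have := is_deriveB (is_derive_cst (1 : R) t 1) (is_derive_id t 1).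
  by rewrite sub0r.
have dp : is_derive t (1 : R) (fun t : R => 1 + t) 1.
  have := is_deriveD (is_derive_cst (1 : R) t 1) (is_derive_id t 1).
  by rewrite add0r.
have d1 := @is_derive1_comp _ (flat 1) (fun t : R => 1 - t) t _ _
  (is_derive_flat 1 (1 - t)) dm.
have d2 := @is_derive1_comp _ (flat 1) (fun t : R => 1 + t) t _ _
  (is_derive_flat 1 (1 + t)) dp.
apply: is_derive_eq (is_deriveM d1 d2) _.
rewrite /dhat /GRing.scale/=; ring.
Qed.

(** One of 1 - t and 1 + t is nonpositive, which kills a factor of every product. The endpoints are
    covered because every [flat p] vanishes at 0. *)
Lemma hat_dhat_out t : 1 <= `|t| -> hat t = 0 /\ dhat t = 0.
Proof.
rewrite ler_normr /hat /dhat => /orP[t1|t1].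
  by rewrite !(flat_nonpos _ (1 - t)) ?subr_le0// !(mulr0, mul0r) subr0.
have t0 : 1 + t <= 0 by lra.
by rewrite !(flat_nonpos _ (1 + t))// !(mulr0, mul0r) subr0.
Qed.

Lemma hat_ge0 t : 0 <= hat t.
Proof. by rewrite mulr_ge0// flat1_ge0. Qed.

Lemma hat_le1 t : hat t <= 1.
Proof.
rewrite /hat mulr_ile1 ?flat1_ge0//.
  by apply: le_trans (flat1_le1 (1 - t)); rewrite ler_norm.
by apply: le_trans (flat1_le1 (1 + t)); rewrite ler_norm.
Qed.

Lemma hat_plateau : exists2 h0 : R, 0 < h0 & forall t, `|t| <= 2^-1 -> h0 <= hat t.
Proof.
exists (flat 1 2^-1 * flat 1 2^-1).
  by rewrite mulr_gt0// flat_pos ?invr_gt0// hornerC mul1r expR_gt0.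
move=> t; rewrite ler_norml => /andP[t1 t2].
by rewrite ler_pM ?flat1_ge0// flat1_nondecreasing//; lra.
Qed.

Lemma dhat_bounded : exists2 D : R, 0 <= D & forall t, `|dhat t| <= D.
Proof.
have [C C0 HC] := flat_bounded (dflat 1).
exists (C + C); first exact: addr_ge0.
move=> t; apply: le_trans (ler_normB _ _) _; rewrite !normrM lerD//.
  by rewrite -[leRHS]mul1r ler_pM// flat1_le1.
by rewrite -[leRHS]mul1r ler_pM// flat1_le1.
Qed.

End FlatFunction.

(** * Smooth product bumps on R^N and their derivatives *)

Section Smoothness.
Context {R : realType} {N : nat}.
Implicit Types (f g : 'rV[R]_N -> R) (x c : 'rV[R]_N) (k : nat).

Lemma eq_Ck k f g : f =1 g -> Ck k g -> Ck k f.
Proof. by move=> /funext ->. Qed.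

Lemma CkW k f : Ck k.+1 f -> Ck k f.
Proof.
elim: k f => [|k IH] f [cf Hf]; first exact: cf.
split=> // i; have [df Cf] := Hf i; split => //.
exact: IH.
Qed.

Lemma Ck_cst k (a : R) : @Ck R N k (fun=> a).
Proof.
elim: k a => [|k IH] a; first exact: cst_continuous.
split; first exact: cst_continuous.
move=> i; split; first by move=> x; have [] := is_derive_cst a x (ebase R i).
apply: (eq_Ck _ _ (fun=> 0)) => [x|].
  exact: derive_cst.
exact: IH.
Qed.

Lemma CkD k f g : Ck k f -> Ck k g -> Ck k (fun x => f x + g x).
Proof.
elim: k f g => [|k IH] f g; first by move=> cf cg x; exact: cvgD (cf x) (cg x).
move=> [cf Hf] [cg Hg]; split; first by move=> x; exact: cvgD (cf x) (cg x).
move=> i; have [df Cf] := Hf i; have [dg Cg] := Hg i.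
split; first by move=> x; exact: derivableD (df x) (dg x).
apply: (eq_Ck _ _ (fun x => 'D_(ebase R i) f x + 'D_(ebase R i) g x)) => [x|].
  exact: deriveD.
exact: IH.
Qed.

(** The product rule pairs a derivative with an undifferentiated factor, so the induction also uses
    each factor at one order less, through [CkW]. *)
Lemma CkM k f g : Ck k f -> Ck k g -> Ck k (fun x => f x * g x).
Proof.
elim: k f g => [|k IH] f g; first by move=> cf cg x; exact: cvgM (cf x) (cg x).
move=> Hf0 Hg0; have [cf Hf] := Hf0; have [cg Hg] := Hg0.
split; first by move=> x; exact: cvgM (cf x) (cg x).
move=> i; have [df Cf] := Hf i; have [dg Cg] := Hg i.
split; first by move=> x; exact: derivableM (df x) (dg x).
apply: (eq_Ck _ _ (fun x => f x * 'D_(ebase R i) g x + g x * 'D_(ebase R i) f x)) => [x|].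
  exact: deriveM.
by apply: CkD; apply: IH => //; exact: CkW.
Qed.

Lemma Ck_prod k (I : Type) (s : seq I) (F : I -> 'rV[R]_N -> R) :
  (forall j, Ck k (F j)) -> Ck k (fun x => \prod_(j <- s) F j x).
Proof.
move=> CF; elim: s => [|j s IH].
  apply: (eq_Ck _ _ (fun=> 1)) => [x|].
    by rewrite big_nil.
  exact: Ck_cst.
apply: (eq_Ck _ _ (fun x => F j x * \prod_(j <- s) F j x)) => [x|].
  by rewrite big_cons.
exact: CkM.
Qed.

(** Reduces directional derivatives to one-variable calculus along a line. *)
Lemma is_derive_line f x (v : 'rV[R]_N) (d : R) :
  is_derive (0 : R) (1 : R) (fun t : R => f (t *: v + x)) d ->
  is_derive x v f d.
Proof.
pose F (t : R) := f (t *: v + x).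
have E : (fun h : R => h^-1 *: ((F \o shift 0) (h *: (1 : R)) - F 0)) =
    (fun h : R => h^-1 *: ((f \o shift x) (h *: v) - f x)).
  apply/funext => h; rewrite /F /= addr0 scale0r add0r.
  by rewrite [_ *: (1 : R)]mulr1.
by move=> [df dE]; split; [rewrite /derivable -E | rewrite /derive -E].
Qed.

Lemma is_derive_coord (g : R -> R) (dg : R) (i j : 'I_N) x :
  is_derive (x ord0 i) (1 : R) g dg ->
  is_derive x (ebase R j) (fun y => g (y ord0 i)) ((i == j)%:R * dg).
Proof.
move=> Hg; apply: is_derive_line.
have E t : (t *: ebase R j + x) ord0 i = t * (i == j)%:R + x ord0 i.
  by rewrite !mxE eqxx.
rewrite (_ : (fun _ => _) = g \o (fun t : R => t * (i == j)%:R + x ord0 i)).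
  rewrite mulrC; apply: is_derive1_comp.
    by rewrite mul0r add0r.
  have := is_deriveD (is_deriveM (is_derive_id (0 : R) 1)
     (is_derive_cst ((i == j)%:R : R) (0 : R) 1)) (is_derive_cst (x ord0 i) (0 : R) 1).
  by rewrite /GRing.scale /= mulr0 add0r mulr1 addr0.
by apply/funext => t; rewrite /= E.
Qed.

(** The induction closes because [p] is arbitrary: each partial derivative is a constant times the
    same expression for [dflat p]. *)
Lemma Ck_flat_coord k (p : {poly R}) (a b : R) (i : 'I_N) :
  Ck k (fun x => flat p (a * x ord0 i + b)).
Proof.
have cf (q : {poly R}) : continuous (fun x => flat q (a * x ord0 i + b)).
  move=> x; apply: (@continuous_comp _ _ _ (fun x => a * x ord0 i + b) (flat q)).
    apply: continuousD; last exact: cst_continuous.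
    by apply: continuousM; [exact: cst_continuous|exact: coord_continuous].
  exact: continuous_flat.
elim: k p => [|k IH] p; first exact: cf.
split => // j.
have D x : is_derive x (ebase R j) (fun x => flat p (a * x ord0 i + b))
    ((i == j)%:R * (a * flat (dflat p) (a * x ord0 i + b))).
  apply: (is_derive_coord (fun t => flat p (a * t + b))).
  rewrite mulrC; apply: (@is_derive1_comp _ (flat p) (fun t => a * t + b)).
    exact: is_derive_flat.
  have := is_deriveD (is_deriveM (is_derive_cst a (x ord0 i) 1)
     (is_derive_id (x ord0 i) 1)) (is_derive_cst b (x ord0 i) 1).
  by rewrite /GRing.scale /= mulr0 !addr0 mulr1.
split; first by move=> x; have [] := D x.
apply: (eq_Ck _ _ (fun x =>
   ((i == j)%:R * a) * flat (dflat p) (a * x ord0 i + b))) => [x|].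
  by have [_ ->] := D x; rewrite mulrA.
by apply: CkM => //; exact: Ck_cst.
Qed.

(** A tensor product, for [0 < b] supported in a cube of half-side [b^-1]: this shape suits both
    iterated integrals and partial derivatives. *)
Definition box_bump (b : R) c x : R := \prod_(i < N) hat (b * (x ord0 i - c ord0 i)).

Lemma smooth_box_bump b c : smooth (box_bump b c).
Proof.
move=> k; apply: Ck_prod => i.
apply: (eq_Ck _ _ (fun x => flat 1 (- b * x ord0 i + (1 + b * c ord0 i)) *
    flat 1 (b * x ord0 i + (1 - b * c ord0 i)))) => [x|].
  by rewrite /hat; congr (flat 1 _ * flat 1 _); ring.
by apply: CkM; exact: Ck_flat_coord.
Qed.

Definition dbox_bump (b : R) c (i : 'I_N) x : R :=
  b * dhat (b * (x ord0 i - c ord0 i)) *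
  \prod_(j < N | j != i) hat (b * (x ord0 j - c ord0 j)).

Lemma is_derive_box_bump b c (i : 'I_N) x :
  is_derive x (ebase R i) (box_bump b c) (dbox_bump b c i x).
Proof.
apply: is_derive_line.
pose P := \prod_(j < N | j != i) hat (b * (x ord0 j - c ord0 j)).
rewrite (_ : (fun _ => _) = fun t : R => hat (b * (t + x ord0 i - c ord0 i)) * P).
  have d1 : is_derive (0 : R) (1 : R)
      (fun t : R => b * (t + x ord0 i - c ord0 i)) b.
    have := is_deriveM (is_derive_cst b (0 : R) 1)
      (is_deriveB (is_deriveD (is_derive_id (0 : R) 1)
        (is_derive_cst (x ord0 i) (0 : R) 1)) (is_derive_cst (c ord0 i) (0 : R) 1)).
    by rewrite /GRing.scale /= mulr0 !addr0 subr0 mulr1.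
  have d2 := @is_derive1_comp _ hat _ 0 _ _
    (is_derive_hat (b * (0 + x ord0 i - c ord0 i))) d1.
  have := is_deriveM d2 (is_derive_cst P (0 : R) 1).
  rewrite /GRing.scale /= mulr0 add0r add0r => H.
  by apply: is_derive_eq H _; rewrite /dbox_bump -/P mulrC [dhat _ * _]mulrC.
apply/funext => t; rewrite /box_bump (bigD1 i)//=; congr (_ * _).
  by rewrite !mxE !eqxx mulr1.
by apply: eq_bigr => j ji; rewrite !mxE eqxx (negPf ji) mulr0 add0r.
Qed.

Lemma box_bump_dbox_bump_out b c x (i0 : 'I_N) :
  1 <= `|b * (x ord0 i0 - c ord0 i0)| ->
  box_bump b c x = 0 /\ forall i, dbox_bump b c i x = 0.
Proof.
move=> /hat_dhat_out[h0 dh0]; split; first by rewrite /box_bump (bigD1 i0)//= h0 mul0r.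
move=> i; rewrite /dbox_bump; have [->|ii] := eqVneq i i0.
  by rewrite dh0 mulr0 mul0r.
by rewrite (bigD1 i0) ?[i0 == i]eq_sym//= h0 mul0r mulr0.
Qed.

Lemma box_bump_ge0 b c x : 0 <= box_bump b c x.
Proof. by apply: prodr_ge0 => i _; exact: hat_ge0. Qed.

Lemma box_bump_le1 b c x : box_bump b c x <= 1.
Proof. by apply: prodr_ile1 => i _; rewrite hat_ge0 hat_le1. Qed.

Lemma dbox_bump_le (D b : R) c i x : 0 <= b -> (forall t, `|dhat t| <= D) ->
  `|dbox_bump b c i x| <= b * D.
Proof.
move=> b0 HD; rewrite /dbox_bump normrM -[leRHS]mulr1 ler_pM//.
  by rewrite normrM ger0_norm// ler_wpM2l.
rewrite ger0_norm ?prodr_ge0//; last by move=> *; exact: hat_ge0.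
by apply: prodr_ile1 => j _; rewrite hat_ge0 hat_le1.
Qed.

Lemma box_bump_plateau (h0 b : R) c x : 0 <= h0 ->
  (forall t, `|t| <= 2^-1 -> h0 <= hat t) ->
  (forall i, `|b * (x ord0 i - c ord0 i)| <= 2^-1) ->
  h0 ^+ N <= box_bump b c x.
Proof.
move=> h00 H xc; rewrite -[X in h0 ^+ X]card_ord -prodr_const.
by apply: ler_prod => i _; rewrite h00 H.
Qed.

(** Each square is at most its absolute value times the full sum. This turns coordinatewise bounds
    into Euclidean ones. *)
Lemma eucl_norm_le_sum x : eucl_norm x <= \sum_(i < N) `|x ord0 i|.
Proof.
have s0 : 0 <= \sum_(i < N) `|x ord0 i| by exact: sumr_ge0.
rewrite /eucl_norm -[leRHS](ger0_norm s0) -sqrtr_sqr ler_wsqrtr//.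
rewrite expr2 mulr_suml; apply: ler_sum => i _.
rewrite -real_normK ?num_real// expr2 ler_wpM2l//.
by rewrite (bigD1 i)//= lerDl sumr_ge0.
Qed.

Lemma Cc_infD f g : Cc_inf f -> Cc_inf g -> Cc_inf (fun x => f x + g x).
Proof.
move=> [sf [rf Hf]] [sg [rg Hg]]; split; first by move=> k; exact: CkD.
exists (Num.max rf rg) => x; rewrite gt_max => /andP[xf xg].
by rewrite Hf// Hg// addr0.
Qed.

Lemma Cc_inf_sum (n : nat) (F : nat -> 'rV[R]_N -> R) :
  (forall j, Cc_inf (F j)) -> Cc_inf (fun x => \sum_(j < n) F j x).
Proof.
move=> CF; elim: n => [|n IH].
  rewrite (_ : (fun x => _) = fun=> 0); last by apply/funext => x; rewrite big_ord0.
  by split; [move=> k; exact: Ck_cst|exists 0].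
rewrite (_ : (fun x => _) = fun x => \sum_(j < n) F j x + F n x).
  exact: Cc_infD.
by apply/funext => x; rewrite big_ord_recr.
Qed.

Lemma Cc_inf_box_bump (a b : R) c : 0 < b -> Cc_inf (fun x => a * box_bump b c x).
Proof.
move=> b0; split; first by move=> k; apply: CkM; [exact: Ck_cst|exact: smooth_box_bump].
exists (\sum_(i < N) (`|c ord0 i| + b^-1)) => x xr.
have [[i /box_bump_dbox_bump_out[-> _]]|H] :=
    pselect (exists i, 1 <= `|b * (x ord0 i - c ord0 i)|); first by rewrite mulr0.
suff : eucl_norm x <= \sum_(i < N) (`|c ord0 i| + b^-1) by rewrite leNgt xr.
apply: le_trans (eucl_norm_le_sum x) _; apply: ler_sum => i _.
rewrite -[x ord0 i](subrK (c ord0 i)) addrC; apply: le_trans (ler_normD _ _) _.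
rewrite lerD2l leNgt; apply/negP => bx; apply: H; exists i.
by rewrite normrM gtr0_norm// mulrC -ler_pdivrMr// div1r ltW.
Qed.

Lemma measurableRN_box_bump b c : measurableRN (box_bump b c).
Proof.
rewrite /measurableRN /box_bump.
have chat : continuous (@hat R).
  move=> t; apply: differentiable_continuous; apply/derivable1_diffP.
  by have [] := is_derive_hat t.
elim: (index_enum _) => [|i s IH].
  by under eq_fun do rewrite big_nil; exact: measurable_cst.
under eq_fun do rewrite big_cons mxE.
apply: measurable_funM => //.
apply: (@measurableT_comp _ _ _ _ _ _ (@hat R)).
  exact: continuous_measurable_fun.
apply: measurable_funM => //; apply: measurable_funB => //.
exact: measurable_tnth.
Qed.

End Smoothness.

(** * Sparse subsequences, growth of powers and centered intervals *)

Section RealSequences.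
Context {R : realType}.

Lemma sum_half_le (n : nat) : \sum_(j < n) (2 : R) ^- j <= 2.
Proof.
suff -> : \sum_(j < n) (2 : R) ^- j = 2 - 2 / 2 ^+ n.
  by rewrite gerBl divr_ge0// exprn_ge0.
elim: n => [|n IH]; first by rewrite big_ord0 expr0 divr1 subrr.
rewrite big_ord_recr /= IH exprS; field.
by rewrite expf_neq0.
Qed.

Lemma sparse_subsequence (M L : nat -> R) (q : R) :
  M @ \oo --> +oo ->
  exists f : nat -> nat, forall k, L k <= M (f k) /\
    forall i, (i < k)%N -> q * M (f i) < M (f k).
Proof.
move=> /cvgryPgt Moo.
have /choice[g gM] : forall A : R, exists n, A < M n.
  by move=> A; have [n _ Hn] := Moo A; exists n; exact: Hn n (leqnn n).
pose q' := Num.max q 1.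
pose f := fix f (k : nat) : nat := if k is k'.+1
  then g (Num.max (Num.max (L k) 0) (q' * M (f k')))
  else g (Num.max (L 0%N) 0).
have fS k : Num.max (L k.+1) 0 < M (f k.+1) /\ q' * M (f k) < M (f k.+1).
  by have := gM (Num.max (Num.max (L k.+1) 0) (q' * M (f k))); rewrite gt_max => /andP[].
have fL k : Num.max (L k) 0 < M (f k).
  by case: k => [|k]; [exact: gM | exact: (fS k).1].
have f0 k : 0 < M (f k) by have := fL k; rewrite gt_max => /andP[].
exists f => k; split; first by have := fL k; rewrite gt_max => /andP[/ltW].
move=> i; elim: k => [//|k IH]; rewrite ltnS leq_eqVlt => /orP[/eqP ->|/IH ik].
  apply: le_lt_trans (fS k).2; rewrite ler_wpM2r ?(ltW (f0 _))//.
  by rewrite le_max lexx.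
apply: (lt_le_trans ik); apply/ltW/(le_lt_trans _ (fS k).2).
by rewrite ler_peMl ?(ltW (f0 _))// le_max lexx orbT.
Qed.

(** With p = tau/2 > 1 and C = y^p, the right side is C lam^p, which exceeds k lam as soon as
    lam^(p-1) >= k/C. *)
Lemma superlinear_powR (y tau : R) (k : nat) : 0 < y -> 2 < tau ->
  exists L : R, forall lam, 0 < lam -> L <= lam ->
    k%:R * lam <= Num.sqrt (lam * y) `^ tau.
Proof.
move=> y0 tau2; pose p := tau / 2; pose C := y `^ p.
have p1 : 0 < p - 1 by rewrite /p; lra.
have C0 : 0 < C by rewrite powR_gt0.
exists ((k%:R / C) `^ (p - 1)^-1) => lam lam0 Llam.
have [lam_ge0 y_ge0] := (ltW lam0, ltW y0).
rewrite -powR12_sqrt ?mulr_ge0// -powRrM [_ * tau]mulrC -/p.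
rewrite powRM// -/C -mulr_powRB1//; last by lra.
rewrite -mulrA mulrC ler_pM2l// -ler_pdivrMr//.
have -> : k%:R / C = ((k%:R / C) `^ (p - 1)^-1) `^ (p - 1).
  by rewrite -powRrM mulVf ?gt_eqF// powRr1// divr_ge0// ltW.
by rewrite ge0_ler_powR ?nnegrE ?powR_ge0// ltW.
Qed.

Lemma lebesgue_measure_ball_itv (c w : R) : 0 < w ->
  lebesgue_measure (`]c - w, c + w[%classic : set R) = (2 * w)%:E.
Proof.
move=> w0; rewrite lebesgue_measure_itv/= lte_fin.
by rewrite ltrD2l gtrN// -EFinB; congr (_%:E); ring.
Qed.

Lemma in_centered_itv (s r rho c t : R) : 0 < s -> 0 < r ->
  `]c - rho * (r / s), c + rho * (r / s)[%classic t <-> `|s / r * (t - c)| < rho.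
Proof.
move=> s0 r0; have -> : (`|s / r * (t - c)| < rho) = (`|t - c| < rho * (r / s)).
  by rewrite normrM gtr0_norm ?divr_gt0// mulrC -ltr_pdivlMr ?divr_gt0// invf_div.
by rewrite ltr_distl /= in_itv /=; split.
Qed.

End RealSequences.

Lemma sum_ord_single (R : realType) (F : nat -> R) (k j0 : nat) :
  (forall j, j != j0 -> F j = 0) ->
  \sum_(j < k) F j = (j0 < k)%:R * F j0.
Proof.
move=> F0; elim: k => [|k IH]; first by rewrite big_ord0 mul0r.
rewrite big_ord_recr /= IH ltnS; case: ltngtP => [jk|jk|->].
- by rewrite (F0 k) ?addr0// gtn_eqF.
- by rewrite (F0 k) ?mul0r ?addr0// ltn_eqF.
- by rewrite mul0r add0r mul1r.
Qed.

(** * Sums of bumps on disjoint cubes *)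

Section DisjointBumps.
Context {R : realType} {N : nat}.
Context (V : 'rV[R]_N -> R) (c : nat -> 'rV[R]_N) (a s : nat -> R) (r c1 c2 : R).

Definition cube j (x : 'rV[R]_N) : Prop :=
  forall i, `|s j / r * (x ord0 i - c j ord0 i)| < 1.

Definition hill j (x : 'rV[R]_N) : R := box_bump (s j / r) (c j) x.

(* Equal to 0 when x lies in no cube; then [hill 0 x = 0] all the same. *)
Definition active (x : 'rV[R]_N) : nat := xget 0%N [set j | cube j x].

Definition hill_psum k (x : 'rV[R]_N) : R := \sum_(j < k) a j * hill j x.

(** For disjoint cubes this is the pointwise limit of the [hill_psum k], as at most one term is
    nonzero at each point. *)
Definition hill_sum (x : 'rV[R]_N) : R := a (active x) * hill (active x) x.

Context (s_gt0 : forall j, 0 < s j) (r_gt0 : 0 < r) (c2_gt0 : 0 < c2).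
Context (cube_disj : forall j k x, cube j x -> cube k x -> j = k).
Context (V_gt0 : forall x, 0 < V x).
Context (V_le : forall j x, cube j x -> V x <= c2 * s j ^+ 2).
Context (a_ge0 : forall j, 0 <= a j).
(** Up to constants, the left side bounds the energy of one hill: squared amplitude, squared
    frequency, volume. Its geometric decay makes the partial sums Cauchy. *)
Context (a_sq : forall j, a j ^+ 2 * s j ^+ 2 * (r / s j) ^+ N = r ^+ N * 2 ^- j).

Let b_gt0 j : 0 < s j / r. Proof. exact: divr_gt0. Qed.

Lemma hill_out j x : ~ cube j x ->
  hill j x = 0 /\ forall i, dbox_bump (s j / r) (c j) i x = 0.
Proof.
move=> /existsNP[i /negP]; rewrite -leNgt => xi.
exact: box_bump_dbox_bump_out xi.
Qed.

Lemma active_cube j x : cube j x -> active x = j.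
Proof.
move=> xj; apply: (cube_disj _ _ x) => //.
by have := @xgetPex _ 0%N [set j | cube j x]; apply; exists j.
Qed.

Lemma hill_psumE k x : hill_psum k x = (active x < k)%:R * hill_sum x.
Proof.
apply: (@sum_ord_single _ (fun j => a j * hill j x)) => j jx.
rewrite (hill_out _ _ _).1 ?mulr0// => /active_cube xj.
by rewrite xj eqxx in jx.
Qed.

(** The sum is differentiated term by term and only then collapsed to one term, since [active] may
    jump at the boundary of a cube. *)
Lemma is_derive_hill_psum k x i :
  is_derive x (ebase R i) (hill_psum k)
    ((active x < k)%:R *
      (a (active x) * dbox_bump (s (active x) / r) (c (active x)) i x)).
Proof.
rewrite -(@sum_ord_single _ (fun j => a j * dbox_bump (s j / r) (c j) i x)); last first.
  move=> j jx; rewrite (hill_out _ _ _).2 ?mulr0// => /active_cube xj.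
  by rewrite xj eqxx in jx.
rewrite (_ : hill_psum k = \sum_(j < k) (a j \*: box_bump (s j / r) (c j))); last first.
  by apply/funext => y; rewrite fct_sumE.
apply: is_derive_sum => j; apply: is_deriveZ; exact: is_derive_box_bump.
Qed.

Lemma Cc_inf_hill_psum k : Cc_inf (hill_psum k).
Proof.
by apply: (Cc_inf_sum k (fun j x => a j * hill j x)) => j; exact: Cc_inf_box_bump.
Qed.

Lemma measurableRN_hill_sum : measurableRN hill_sum.
Proof.
rewrite /measurableRN; apply/measurable_EFinP.
apply: (@emeasurable_fun_cvg _ _ _ _
  (fun k (t : N.-tuple R) => (hill_psum k (\row_i tnth t i))%:E)).
  move=> k; apply/measurable_EFinP; apply: measurable_sum => j.
  by apply: measurable_funM => //; exact: measurableRN_box_bump.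
move=> t _; apply: cvg_near_cst; exists (active (\row_i tnth t i)).+1 => //= k /= tk.
by rewrite hill_psumE tk mul1r.
Qed.

(* A function dominated by [A a_j^2 s_j^2] on the cubes of index at least [K]
   has integral [O(2^-K)], by the choice of the amplitudes [a_j]. *)
Lemma intRN_tail_le (A : R) (K : nat) (g : 'rV[R]_N -> R) : 0 <= A ->
  (forall x, 0 <= g x) ->
  (forall x, g x = 0 \/ [/\ (K <= active x)%N, cube (active x) x &
     g x <= A * (a (active x) ^+ 2 * s (active x) ^+ 2)]) ->
  (intRN (fun x => (g x)%:E) <= (A * (2 * r) ^+ N * 2 * 2 ^- K)%:E)%E.
Proof.
move=> A0 g0 gA.
have w0 j : 0 < 1 * (r / s j) by rewrite mul1r divr_gt0.
(* The shift by [K] keeps only the cubes of the tail; the factor 1 is the [rho] of [in_centered_itv]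
   for the full cube. *)
apply: (@le_intRN_nneseries_box _ _ _
  (fun j => A * (a (K + j)%N ^+ 2 * s (K + j)%N ^+ 2))
  (fun j i => `](c (K + j)%N ord0 i - 1 * (r / s (K + j)%N)),
                (c (K + j)%N ord0 i + 1 * (r / s (K + j)%N))[%classic)
  (fun j i => 2 * (1 * (r / s (K + j)%N)))) => //.
- by move=> j; rewrite mulr_ge0// mulr_ge0// sqr_ge0.
- by move=> j i; rewrite mulr_ge0// ltW.
- by move=> j i; exact: lebesgue_measure_ball_itv.
- move=> x; have [->|[Kx xc gx]] := gA x; first by left.
  right; exists (active x - K)%N; rewrite subnKC//.
  by move=> i; apply/in_centered_itv => //; exact: xc.
(* By [a_sq] the terms are geometric in [j], with sum at most 2: hence the factor 2 in the bound. *)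
- move=> n; rewrite (eq_bigr (fun j : 'I_n => A * (2 * r) ^+ N * 2 ^- K * 2 ^- j)).
    rewrite -mulr_sumr [leRHS]mulrAC ler_wpM2l ?sum_half_le//.
    by rewrite !mulr_ge0// ?invr_ge0 ?exprn_ge0// mulr_ge0// ltW.
  move=> j _; rewrite prodr_const card_ord mul1r exprMn.
  rewrite mulrCA !mulrA -[X in X * _]mulrA.
  have -> : A * (2 * r) ^+ N * 2 ^- K * 2 ^- j =
            A * 2 ^+ N * (r ^+ N * 2 ^- (K + j)).
    by rewrite exprMn exprD invfM; ring.
  by rewrite -a_sq; ring.
Qed.

Lemma hill_sum_sq_le x : hill_sum x ^+ 2 <= a (active x) ^+ 2.
Proof.
rewrite /hill_sum exprMn ler_piMr ?sqr_ge0// expr_le1 ?box_bump_ge0 ?box_bump_le1//.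
Qed.

Lemma H1V_hill_sum : H1V V hill_sum.
Proof.
split; first exact: measurableRN_hill_sum.
have [D D0 HD] := @dhat_bounded R.
(* The first term accounts for the [N] partial derivatives, each at most [a j * (s j / r * D)], and
   [c2] for the potential. *)
pose A := N%:R * (D / r) ^+ 2 + c2.
have A0 : 0 <= A by rewrite addr_ge0 ?(ltW c2_gt0)// mulr_ge0// sqr_ge0.
have c2A : c2 <= A by rewrite lerDr mulr_ge0// sqr_ge0.
pose B := A * (2 * r) ^+ N * 2.
have B0 : 0 <= B by rewrite !mulr_ge0// exprn_ge0// mulr_ge0// ltW.
have small (eps : R) : 0 < eps -> exists K : nat, forall k, (K <= k)%N ->
    B * 2 ^- k <= eps.
  move=> e0.
  have : geometric B (2^-1 : R) k @[k --> \oo] --> 0.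
    by apply: cvg_geometric; rewrite ger0_norm// invf_lt1// ltr1n.
  move/cvgrPdist_le => /(_ _ e0)[K _ HK]; exists K => k Kk.
  have := HK k Kk; rewrite /= sub0r normrN exprVn.
  by apply: le_trans; rewrite ler_norm.
have Vu x : cube (active x) x -> V x * hill_sum x ^+ 2 <=
    c2 * (a (active x) ^+ 2 * s (active x) ^+ 2).
  move=> xc; rewrite mulrA mulrAC ler_pM ?sqr_ge0 ?hill_sum_sq_le ?(ltW (V_gt0 x))//.
  exact: V_le.
have u0 x : ~ cube (active x) x -> hill_sum x = 0.
  by move=> /hill_out[h0 _]; rewrite /hill_sum h0 mulr0.
exists hill_psum; split; first exact: Cc_inf_hill_psum.
split=> [eps e0|eps e0]; have [K HK] := small eps e0; exists K.
- move=> k l Kk Kl; apply: le_trans (_ : (B * 2 ^- K)%:E <= _)%E; last first.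
    by rewrite lee_fin HK.
  (* The difference of two partial sums, and its gradient, are those of the active term times [E],
     which is -1, 0 or 1 and vanishes when the active index is below [K]. *)
  pose E x : R := (active x < k)%:R - (active x < l)%:R.
  have E1 x : E x ^+ 2 <= 1.
    by rewrite /E; case: (_ < k)%N; case: (_ < l)%N;
      rewrite ?subrr ?subr0 ?sub0r ?sqrrN ?expr1n ?expr0n.
  have E0 x : (active x < K)%N -> E x = 0.
    by move=> xK; rewrite /E !(leq_trans xK)// subrr.
  have DE x i : 'D_(ebase R i) (fun x => hill_psum k x - hill_psum l x) x =
      E x * (a (active x) * dbox_bump (s (active x) / r) (c (active x)) i x).
    rewrite (@derive_val _ _ _ _ _ _ _
      (is_deriveB (is_derive_hill_psum k x i) (is_derive_hill_psum l x i))).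
    by rewrite -mulrBl.
  have FE x : hill_psum k x - hill_psum l x = E x * hill_sum x.
    by rewrite !hill_psumE -mulrBl.
  rewrite /normV_sq; apply: intRN_tail_le => // x.
    rewrite addr_ge0//; first by apply: sumr_ge0 => i _; exact: sqr_ge0.
    by rewrite mulr_ge0 ?sqr_ge0// ltW.
  have GE : grad_sq (fun x => hill_psum k x - hill_psum l x) x =
      E x ^+ 2 * \sum_(i < N) (a (active x) *
        dbox_bump (s (active x) / r) (c (active x)) i x) ^+ 2.
    by rewrite /grad_sq mulr_sumr; apply: eq_bigr => i _; rewrite DE exprMn.
  rewrite GE FE exprMn.
  have [xc|xc] := pselect (cube (active x) x); last first.
    left; rewrite u0// big1 => [|i _]; last by rewrite (hill_out _ _ xc).2 mulr0 expr0n.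
    by rewrite expr0n !mulr0 addr0.
  have [Kx|xK] := leqP K (active x); last by left; rewrite E0// expr0n !mul0r mulr0 addr0.
  right; split => //.
  rewrite mulrCA -mulrDr; set T := _ + _.
  have T0 : 0 <= T.
    rewrite addr_ge0//; first by apply: sumr_ge0 => i _; exact: sqr_ge0.
    by rewrite mulr_ge0 ?sqr_ge0// ltW.
  apply: (@le_trans _ _ T); first by rewrite ler_piMl.
  rewrite /T /A mulrDl lerD ?Vu//.
  apply: (@le_trans _ _ (\sum_(i < N) a (active x) ^+ 2 * (s (active x) / r * D) ^+ 2)).
    apply: ler_sum => i _; rewrite exprMn ler_wpM2l ?sqr_ge0//.
    rewrite -[leLHS]real_normK ?num_real//; apply: lerXn2r.
    - by rewrite nnegrE.
    - by rewrite nnegrE mulr_ge0// ltW.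
    - by apply: dbox_bump_le => //; exact: ltW.
  rewrite sumr_const card_ord -mulr_natl le_eqVlt; apply/orP; left; apply/eqP.
  by field; rewrite gt_eqF.
- move=> k Kk; apply: le_trans (_ : (B * 2 ^- K)%:E <= _)%E; last first.
    by rewrite lee_fin HK.
  apply: intRN_tail_le => // x; first by rewrite mulr_ge0 ?sqr_ge0// ltW.
  rewrite hill_psumE -[X in _ - X]mul1r -mulrBl.
  have [xc|xc] := pselect (cube (active x) x); last first.
    by left; rewrite u0// mulr0 expr0n mulr0.
  have [kx|xk] := leqP k (active x); last by left; rewrite subrr mul0r expr0n mulr0.
  right; split => //; first exact: leq_trans kx.
  rewrite sub0r mulN1r sqrrN; apply: le_trans (Vu x xc) _.
  by rewrite ler_wpM2r// mulr_ge0// sqr_ge0.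
Qed.

Context (c1_gt0 : 0 < c1).
Context (V_ge : forall j x, cube j x -> c1 * s j ^+ 2 <= V x).

(** On the concentric cube of half the size, each hill is at least [h0 ^+ N]; the growth hypothesis
    then bounds the integral below by [k%:R * kap] for every [k]. *)
Lemma not_LtauV_hill_sum (tau : R) : 0 <= tau ->
  (forall k, k%:R * r ^+ N <= s k ^+ 2 * a k `^ tau * (r / s k) ^+ N) ->
  ~ LtauV V tau hill_sum.
Proof.
move=> tau0 ak [_]; set g := (fun x => _).
have [h0 h00 Hh0] := @hat_plateau R.
pose kap := c1 * (h0 ^+ N) `^ tau * r ^+ N.
have kap0 : 0 < kap by rewrite !mulr_gt0 ?powR_gt0 ?exprn_gt0.
have low k : ((k%:R * kap)%:E <= intRN g)%E.
  have w0 : 0 < 2^-1 * (r / s k) by rewrite mulr_gt0 ?invr_gt0// divr_gt0.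
  apply: (@le_trans _ _ ((c1 * s k ^+ 2 * (a k * h0 ^+ N) `^ tau *
     \prod_(i < N) (2 * (2^-1 * (r / s k))))%:E)).
    rewrite lee_fin prodr_const card_ord mulVKf// powRM// ?exprn_ge0 ?(ltW h00)//.
    rewrite /kap (_ : k%:R * _ = c1 * (h0 ^+ N) `^ tau * (k%:R * r ^+ N)); last by ring.
    rewrite [leRHS](_ : _ = c1 * (h0 ^+ N) `^ tau *
       (s k ^+ 2 * a k `^ tau * (r / s k) ^+ N)); last by ring.
    by rewrite ler_wpM2l ?ak// mulr_ge0 ?powR_ge0 ?(ltW c1_gt0).
  apply: (@ge_intRN_box _ _ _ _ (fun i => `](c k ord0 i - 2^-1 * (r / s k)),
                (c k ord0 i + 2^-1 * (r / s k))[%classic)) => //.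
  - by rewrite mulr_ge0 ?powR_ge0// mulr_ge0 ?sqr_ge0// ltW.
  - by move=> i; rewrite mulr_ge0// ltW.
  - by move=> i; exact: lebesgue_measure_ball_itv.
  - by move=> x; rewrite mulr_ge0 ?powR_ge0// ltW.
  move=> x xI.
  have xh i : `|s k / r * (x ord0 i - c k ord0 i)| < 2^-1.
    by apply/in_centered_itv => //; exact: xI.
  have xc : cube k x.
    by move=> i; apply: lt_trans (xh i) _; rewrite invf_lt1// ltr1n.
  apply: ler_pM; rewrite ?powR_ge0 ?V_ge//.
    by rewrite mulr_ge0 ?sqr_ge0// ltW.
  have ux : a k * h0 ^+ N <= hill_sum x.
    rewrite /hill_sum (active_cube _ _ xc) ler_wpM2l//.
    by apply: box_bump_plateau => // [|i]; exact: ltW.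
  have a0 : 0 <= a k * h0 ^+ N by rewrite mulr_ge0// exprn_ge0// ltW.
  have u0 := le_trans a0 ux.
  by rewrite ge0_ler_powR ?nnegrE// ger0_norm.
rewrite ltNge => /negP; apply; rewrite leye_eq; apply/eqP/eq_infty => t.
have [t0|t0] := leP t 0.
  by apply: le_trans (low 0%N); rewrite mul0r lee_fin.
apply: le_trans (low (Num.bound (t / kap))); rewrite lee_fin -ler_pdivrMr//.
by apply/ltW/archi_boundP; rewrite divr_ge0// ltW.
Qed.

End DisjointBumps.

(** * Choice of the subsequence, the scales and the amplitudes *)

Theorem theorem2p3 (R : realType) (N : nat) (V : 'rV[R]_N -> R)
  (c1 c2 m : R) (xs : nat -> 'rV[R]_N) :
  (3 <= N)%N ->
  continuous V ->
  (exists v0 : R, 0 < v0 /\ forall x, v0 <= V x) ->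
  0 < c1 -> 0 < c2 -> 0 < m ->
  (fun n => V (xs n)) @ \oo --> +oo ->
  (forall n x, eucl_norm (x - xs n) < m / Num.sqrt (V (xs n)) ->
      c1 * V (xs n) <= V x /\ V x <= c2 * V (xs n)) ->
  forall tau : R, 2 < tau ->
    exists u : 'rV[R]_N -> R, H1V V u /\ ~ LtauV V tau u.
Proof.
move=> N3 _ [v0 [v0_gt0 Vv0]] c1_gt0 c2_gt0 m_gt0 Voo Vball tau tau2.
have V_gt0 x : 0 < V x by exact: lt_le_trans (Vv0 x).
have /choice[L HL] : forall k : nat, exists L : R, forall lam, 0 < lam ->
    L <= lam -> k%:R * lam <= Num.sqrt (lam * 2 ^- k) `^ tau.
  by move=> k; apply: superlinear_powR => //; rewrite invr_gt0 exprn_gt0.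
(* After square roots the threshold gives [1 <= s k] and [L k <= s k]; the ratio [c2 / c1] separates
   the cubes. *)
have [f Hf] := @sparse_subsequence R _ (fun k => Num.max 1 (L k ^+ 2)) (c2 / c1) Voo.
pose c k := xs (f k).
pose s k := Num.sqrt (V (c k)).
(* The exponent balances [s k ^+ 2] against the volume [(r / s k) ^+ N]: the product of the three is
   [r ^+ N]. *)
pose lam k := s k ^+ (N - 2).
pose a k := Num.sqrt (lam k * 2 ^- k).
(* Then [N%:R * r < m], so the [N] coordinate offsets in a cube sum to less than the radius
   [m / s k]. *)
pose r := m / N.+1%:R.
have r_gt0 : 0 < r by rewrite divr_gt0.
have s_gt0 k : 0 < s k by rewrite sqrtr_gt0.
have s_sq k : s k ^+ 2 = V (c k) by rewrite sqr_sqrtr// ltW.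
have s_ge k : 1 <= s k /\ L k <= s k.
  have [+ _] := Hf k; rewrite ge_max => /andP[M1 ML]; split.
    by rewrite -sqrtr1 ler_wsqrtr.
  by apply: le_trans (ler_norm _) _; rewrite -sqrtr_sqr ler_wsqrtr.
have lam_gt0 k : 0 < lam k by rewrite exprn_gt0.
have lamL k : L k <= lam k.
  (* Here [1 <= s k] and [1 <= N - 2] give [s k <= lam k]. *)
  apply: le_trans (s_ge k).2 _; rewrite -[leLHS]expr1 /lam.
  by rewrite ler_weXn2l ?(s_ge k).1// subn_gt0.
have lam_s k : lam k * s k ^+ 2 = s k ^+ N by rewrite -exprD subnK// ltnW.
have a_sqE k : a k ^+ 2 = lam k * 2 ^- k.
  by rewrite sqr_sqrtr// mulr_ge0 ?(ltW (lam_gt0 k))// invr_ge0 exprn_ge0.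
have box k x : cube c s r k x -> eucl_norm (x - c k) < m / s k.
  move=> xk; apply: le_lt_trans (eucl_norm_le_sum _) _.
  apply: (@le_lt_trans _ _ (\sum_(i < N) r / s k)).
    apply: ler_sum => i _; rewrite !mxE ltW//.
    have := xk i; rewrite normrM gtr0_norm ?divr_gt0//.
    by rewrite mulrC -ltr_pdivlMr ?divr_gt0// invf_div mul1r.
  rewrite sumr_const card_ord -mulr_natl mulrA ltr_pM2r ?invr_gt0//.
  by rewrite /r mulrCA gtr_pMr// ltr_pdivrMr// mul1r ltr_nat.
have V_ge k x : cube c s r k x -> c1 * s k ^+ 2 <= V x.
  by move=> /box /Vball[]; rewrite s_sq.
have V_le k x : cube c s r k x -> V x <= c2 * s k ^+ 2.
  by move=> /box /Vball[_]; rewrite s_sq.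
(* A common point would give [c1 * V (c k) <= V x <= c2 * V (c j)], against the sparsity of the
   subsequence. *)
have disj_lt j k x : (j < k)%N -> cube c s r j x -> ~ cube c s r k x.
  move=> jk xj xk; have := (Hf k).2 j jk.
  rewrite -/(c j) -/(c k) mulrAC ltr_pdivrMr// ltNge mulrC.
  by rewrite -!s_sq (le_trans (V_ge _ _ xk))// V_le.
have disj j k x : cube c s r j x -> cube c s r k x -> j = k.
  move=> xj xk; case: (ltngtP j k) => // jk.
    by have := disj_lt _ _ _ jk xj xk.
  by have := disj_lt _ _ _ jk xk xj.
exists (hill_sum c a s r); split.
  apply: (@H1V_hill_sum _ _ _ _ _ _ _ c2) => // j.
  rewrite a_sqE (mulrAC (lam j)) lam_s (expr_div_n r).
  by field; rewrite !expf_neq0//= gt_eqF.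
apply: (@not_LtauV_hill_sum _ _ _ _ _ _ _ c1) => //.
- by move=> j; exact: sqrtr_ge0.
- by apply: ltW; apply: lt_trans tau2.
move=> k; have sn0 : s k != 0 by rewrite gt_eqF.
(* Cancelling [s k ^+ 2] and the volume leaves exactly the inequality that defines [L k]. *)
have -> : k%:R * r ^+ N = s k ^+ 2 * (k%:R * lam k) * (r / s k) ^+ N.
  by rewrite (expr_div_n r) -lam_s; field; rewrite sn0 gt_eqF.
apply: ler_wpM2r; first by rewrite exprn_ge0// ltW// divr_gt0.
by apply: ler_wpM2l; [exact: sqr_ge0|exact: HL].
Qed.
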